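(* Consider the DC power flow model on a grid $\mathcal G$ with independent Gaussian nodal injection fluctuations. Let $(ij)$ be an edge of $\mathcal G$ that is part of only one triangular subgraph, on nodes $i,j,k$ with edges $(ij),(jk),(ik)$. Write $\sigma_a=\Sigma_p(a,a)$. Then $\Sigma_\theta^{-1}(i,j)<0$ if $$\beta_{ij}>-\frac{\sigma_j\beta_{ik}+\sigma_i\beta_{jk}}{2(\sigma_i+\sigma_j)}+\sqrt{\left(\frac{\sigma_j\beta_{ik}+\sigma_i\beta_{jk}}{2(\sigma_i+\sigma_j)}\right)^2+\frac{\sigma_i\sigma_j\beta_{ik}\beta_{jk}}{\sigma_k(\sigma_i+\sigma_j)}}.$$
   Context: Power grid: a finite connected simple undirected graph with $N$ non-reference buses and one reference bus; each line $(ij)$ has susceptance $\beta_{ij}=\beta_{ji}>0$. The reference bus is ignored in the analysis: $\mathcal G$ denotes the graph on the $N$ non-reference buses, with the lines between them as edges. Reduced weighted Laplacian $H_\beta\in\mathbb R^{N\times N}$: $H_\beta(i,i)=\sum_k\beta_{ik}$ (sum over all lines at $i$, including a line to the reference bus), $H_\beta(i,j)=-\beta_{ij}$ if $(ij)$ is a line between distinct non-reference buses, and $0$ otherwise. $H_\beta$ is invertible. DC power flow model: $p=H_\beta\theta$, with $p\sim\mathcal N(0,\Sigma_p)$ the active injections, $\Sigma_p$ diagonal with positive diagonal entries, and $\theta$ the phase angles; the covariance matrix of $\theta$ is $\Sigma_\theta=H_\beta^{-1}\Sigma_pH_\beta^{-1}$. *)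

(* Defs.v *)
From mathcomp Require Import all_boot all_order all_algebra.
From mathcomp Require Import all_classical all_reals all_analysis.

Set Implicit Arguments.
Unset Strict Implicit.
Unset Printing Implicit Defensive.

Import Order.TTheory GRing.Theory Num.Theory.
Local Open Scope ring_scope.

(** The buses are [option 'I_N]: [None] is the reference bus and [Some i], for
    [i : 'I_N], are the [N] non-reference buses.  The value of [susc] on pairs
    of buses that are not joined by a line is irrelevant. *)
Record grid (R : realType) (N : nat) := Grid {
  line : rel (option 'I_N);
  susc : option 'I_N -> option 'I_N -> R;
  line_sym : symmetric line;
  line_irr : irreflexive line;
  line_connected : forall x y, connect line x y;
  susc_sym : forall x y, line x y -> susc x y = susc y x;
  susc_gt0 : forall x y, line x y -> 0 < susc x y
}.

Section Grid.
Variables (R : realType) (N : nat) (G : grid R N).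

Definition edge : rel 'I_N := fun i j => line G (Some i) (Some j).

Definition beta (i j : 'I_N) : R := susc G (Some i) (Some j).

(** A triangular subgraph of the graph on the non-reference buses, given by its
    set of nodes. *)
Definition triangle (T : {set 'I_N}) : bool :=
  (#|T| == 3)%N && [forall x in T, forall y in T, (x != y) ==> edge x y].

Definition triangles_on (i j : 'I_N) : {set {set 'I_N}} :=
  finset (fun T : {set 'I_N} => [&& triangle T, i \in T & j \in T]).

(** The diagonal sum runs over all lines at [i], including the one to the
    reference bus [None], if any. *)
Definition laplacian : 'M[R]_N :=
  \matrix_(i, j)
    if i == j then \sum_(x | line G (Some i) x) susc G (Some i) x
    else if edge i j then - beta i j else 0.

End Grid.

(** [normal_prob m s] takes the standard deviation [s], and is not a Dirac
    mass for [s = 0]. *)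
Definition normal_law (R : realType) (m v : R) : set R -> \bar R :=
  if v == 0 then \d_m else normal_prob m (Num.sqrt v).

Section RandomVectors.
Context d (Omega : measurableType d) (R : realType) (P : probability Omega R).
Variables (N : nat) (X : 'I_N -> {RV P >-> R}).

Definition vec (w : Omega) : 'cV[R]_N := \col_i X i w.

(** [X] has law N(mu, Sigma): every linear combination [a *m X] has the
    univariate normal law of mean [a *m mu] and variance [a *m Sigma *m a^T]. *)
Definition gaussian (mu : 'cV[R]_N) (Sigma : 'M[R]_N) : Prop :=
  forall (a : 'rV[R]_N) (A : set R), measurable A ->
    P ((fun w => (a *m vec w) 0 0) @^-1` A)%classic =
    normal_law ((a *m mu) 0 0) ((a *m Sigma *m a^T) 0 0) A.

Definition cov_mx : 'M[R]_N :=
  \matrix_(i, j) fine (covariance P (X i) (X j)).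

End RandomVectors.

(* Main.v *)
Require Import Defs.
From mathcomp Require Import all_boot all_order all_algebra.
From mathcomp Require Import all_classical all_reals all_analysis.
From mathcomp Require Import measurable_realfun ring lra.

(** Linear forms in [p] are centred Gaussian with variance given by [Sigma_p], so
    the covariance of [theta = H^-1 p] is a positive multiple of
    [H^-1 Sigma_p H^-1], where [H] is invertible by the maximum principle.  The
    [(i, j)] entry of its inverse is therefore a positive multiple of
    [\sum_l H_li H_lj / sigma_l].  Only [l = i, j, k] contribute, since any other
    common neighbour of [i] and [j] would give a second triangle on [(ij)]; as
    [H_ii >= beta_ij + beta_ik] and [H_jj >= beta_ij + beta_jk], the sum is at
    most a quadratic in [beta_ij], negative beyond its positive root. *)

Set Implicit Arguments.
Unset Strict Implicit.
Unset Printing Implicit Defensive.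

Import Order.TTheory GRing.Theory Num.Theory.
Local Open Scope ring_scope.

Lemma sum_option (V : nmodType) (I : finType) (F : option I -> V) :
  \sum_x F x = F None + \sum_i F (Some i).
Proof.
rewrite (bigD1 None)//=; congr (_ + _).
rewrite (reindex_omap Some id)/=; last by case.
by apply: eq_bigl => i; rewrite eqxx.
Qed.

(** * The grounded Laplacian: invertibility, and the sign of the weighted sum on an edge *)

Section Grid.
Variables (R : realType) (N : nat) (G : grid R N).

Lemma edge_sym : symmetric (edge G).
Proof. by move=> i j; exact: line_sym. Qed.

Lemma edge_neq i j : edge G i j -> i != j.
Proof.
by move=> ij; apply/eqP => eij; move: ij; rewrite /edge eij line_irr.
Qed.

Lemma beta_sym i j : edge G i j -> beta G i j = beta G j i.
Proof. exact: susc_sym. Qed.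

Lemma laplacian_diag i :
  laplacian G i i = \sum_(x | line G (Some i) x) susc G (Some i) x.
Proof. by rewrite mxE eqxx. Qed.

Lemma laplacian_edge i j : edge G i j -> laplacian G i j = - beta G i j.
Proof. by move=> ij; rewrite mxE ij (negPf (edge_neq ij)). Qed.

Lemma laplacian_nonedge i j : i != j -> ~~ edge G i j -> laplacian G i j = 0.
Proof. by move=> ij nij; rewrite mxE (negPf ij) (negPf nij). Qed.

Lemma laplacian_tr : (laplacian G)^T = laplacian G.
Proof.
apply/matrixP => i j; rewrite mxE; have [->//|ij] := eqVneq i j.
have [eij|eij] := boolP (edge G i j); last first.
  by rewrite !laplacian_nonedge// 1?eq_sym// edge_sym.
have eji : edge G j i by rewrite edge_sym.
by rewrite (laplacian_edge eij) (laplacian_edge eji) beta_sym.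
Qed.

(** All other lines at [i], including one to the reference bus, only add positive susceptances. *)
Lemma laplacian_diag_ge2 i j k : j != k -> edge G i j -> edge G i k ->
  beta G i j + beta G i k <= laplacian G i i.
Proof.
move=> jk ij ik; rewrite laplacian_diag (bigD1 (Some j))//= (bigD1 (Some k))/=.
  by rewrite addrA lerDl sumr_ge0// => x /andP[/andP[/susc_gt0/ltW]].
by rewrite -/(edge G i k) ik eq_sym.
Qed.

(** The reference bus is grounded at potential 0, which lets the Laplacian act as a sum over all
    lines. *)
Definition potential (u : 'cV[R]_N) (x : option 'I_N) : R :=
  if x is Some i then u i 0 else 0.

Lemma mul_laplacian (u : 'cV[R]_N) i :
  (laplacian G *m u) i 0 = \sum_(x | line G (Some i) x)
    susc G (Some i) x * (potential u (Some i) - potential u x).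
Proof.
under [RHS]eq_bigr do rewrite mulrBr.
rewrite sumrB -mulr_suml -laplacian_diag mxE (bigD1 i)//=; congr (_ + _).
rewrite [in RHS]big_mkcond sum_option/= mulr0 if_same add0r.
rewrite [in RHS](bigD1 i)//= line_irr add0r -sumrN; apply: eq_bigr => j.
rewrite eq_sym => ij; have [eij|eij] := boolP (edge G i j).
  by rewrite laplacian_edge// [line _ _ _]eij mulNr.
by rewrite laplacian_nonedge// [line _ _ _](negPf eij) mul0r oppr0.
Qed.

(* Maximum principle: the set where a harmonic potential is maximal is closed
   under lines, so by connectedness it would reach the grounded bus. *)
Lemma laplacian_ker_le0 (u : 'cV[R]_N) :
  laplacian G *m u = 0 -> forall i, u i 0 <= 0.
Proof.
move=> Hu0 i; pose v := potential u.
rewrite -[u i 0]/(v (Some i)).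
case: (@arg_maxP _ _ _ None xpredT v) => //= m _ vmax.
apply: le_trans (vmax (Some i) isT) _; rewrite leNgt; apply/negP => vm_gt0.
have csym : connect_sym (line G) by apply: sym_connect_sym; exact: line_sym.
have cl : fingraph.closed (line G) [pred x | v x == v m].
  apply: intro_closed => // x y xy; rewrite !inE => /eqP vx.
  case: x xy vx => [j jy vj|_ v0]; last by rewrite -v0 ltxx in vm_gt0.
  (* At a maximal bus [j], the sum of [susc * (v j - v x)] over its lines is zero with nonnegative
     terms, so every neighbour [x] has the same potential. *)
  have := mul_laplacian u j; rewrite Hu0 mxE => /esym/psumr_eq0P.
  move=> /(_ _)/(_ y jy)/eqP; rewrite mulf_eq0 gt_eqF ?susc_gt0//= subr_eq0.
  rewrite -[u j 0]/(v (Some j)) vj eq_sym; apply=> z jz; rewrite mulr_ge0//.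
    by rewrite ltW// susc_gt0.
  by rewrite subr_ge0; exact: vmax.
have := closed_connect cl (line_connected G m None).
by rewrite !inE eqxx => /esym/eqP v0; rewrite -v0 ltxx in vm_gt0.
Qed.

(** By symmetry a left kernel vector is a right one; the maximum principle applied to it and to its
    opposite forces it to vanish. *)
Lemma laplacian_unit : laplacian G \in unitmx.
Proof.
rewrite -row_free_unit; apply: inj_row_free => u Hu.
have Hu0 : laplacian G *m u^T = 0 by rewrite -laplacian_tr -trmx_mul Hu trmx0.
have HuN0 : laplacian G *m (- u^T) = 0 by rewrite mulmxN Hu0 oppr0.
apply/rowP => i; rewrite [RHS]mxE; apply/eqP; rewrite eq_le.
have := laplacian_ker_le0 Hu0 i; have := laplacian_ker_le0 HuN0 i.
by rewrite !mxE oppr_le0 => -> ->.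
Qed.

(** The set of [i], [j], [l] is a triangle on the edge, hence equals that of [i], [j], [k]; since
    [l] differs from [i] and [j], it must be [k]. *)
Lemma common_neighbor i j k l :
    edge G i j -> triangles_on G i j = [set [set i; j; k]]%SET ->
    edge G l i -> edge G l j -> l = k.
Proof.
move=> ij tri li lj; have liN := edge_neq li; have ljN := edge_neq lj.
have : [set i; j; l]%SET \in triangles_on G i j.
  rewrite !inE !eqxx orbT /= andbT /triangle.
  rewrite -finset.setUA cardsU1 cards2 !inE negb_or (edge_neq ij).
  rewrite [i == l]eq_sym liN [j == l]eq_sym ljN.
  apply/andP; split=> //.
  apply/forall_inP => x; rewrite !inE => xP; apply/forall_inP => y.
  rewrite !inE => yP; apply/implyP.
  case/or3P: xP => /eqP->; case/or3P: yP => /eqP->; rewrite ?eqxx// => _ //;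
    by rewrite edge_sym.
rewrite tri inE => /eqP/setP/(_ l); rewrite !inE eqxx !orbT.
by rewrite (negPf liN) (negPf ljN) => /esym/eqP.
Qed.

Lemma weighted_laplacian_sqr_lt0 (sigma : 'I_N -> R) i j k :
    (forall a, 0 < sigma a) ->
    edge G i j -> edge G j k -> edge G i k ->
    triangles_on G i j = [set [set i; j; k]]%SET ->
  let b := (sigma j * beta G i k + sigma i * beta G j k)
             / (2 * (sigma i + sigma j)) in
  beta G i j > - b + Num.sqrt (b ^+ 2
    + (sigma i * sigma j * beta G i k * beta G j k)
        / (sigma k * (sigma i + sigma j))) ->
  \sum_l laplacian G l i * (sigma l)^-1 * laplacian G l j < 0.
Proof.
move=> s_gt0 ij jk ik tri b.
have ijN := edge_neq ij; have jkN := edge_neq jk; have ikN := edge_neq ik.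
have jiN : j != i by rewrite eq_sym.
have kiN : k != i by rewrite eq_sym.
have kjN : k != j by rewrite eq_sym.
rewrite (bigD1 i)//= (bigD1 j)//= (bigD1 k)/= ?kiN//.
rewrite big1 ?addr0; last first.
  move=> l /andP[/andP[li lj] lk].
  have [lEi|lEi] := boolP (edge G l i); last by rewrite laplacian_nonedge ?mul0r.
  have [lEj|lEj] := boolP (edge G l j); last first.
    by rewrite [X in _ * X]laplacian_nonedge ?mulr0.
  by move: lk; rewrite (common_neighbor ij tri lEi lEj) eqxx.
have [ki kj ji] : [/\ edge G k i, edge G k j & edge G j i].
  by rewrite ![edge G k _]edge_sym [edge G j i]edge_sym.
rewrite ![laplacian G k _]laplacian_edge// (laplacian_edge ij) (laplacian_edge ji).
rewrite (beta_sym ki) (beta_sym kj) (beta_sym ji).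
have Hi := laplacian_diag_ge2 jkN ij ik.
have Hj := laplacian_diag_ge2 ikN ji jk; rewrite (beta_sym ji) in Hj.
have x_gt0 : 0 < beta G i j by exact: susc_gt0.
have y_gt0 : 0 < beta G i k by exact: susc_gt0.
have z_gt0 : 0 < beta G j k by exact: susc_gt0.
move: (s_gt0 i) (s_gt0 j) (s_gt0 k) Hi Hj x_gt0 y_gt0 z_gt0; rewrite /b.
move: (sigma i) (sigma j) (sigma k) (beta G i j) (beta G i k) (beta G j k).
move: (laplacian G i i) (laplacian G j j) => Hi Hj si sj sk x y z.
move=> si0 sj0 sk0 xyHi xzHj x0 y0 z0.
set c := _ / _; set q := _ / _ => xlt.
have c_ge0 : 0 <= c by rewrite /c divr_ge0 ?mulr_ge0 ?addr_ge0 ?mulr_ge0 ?ltW.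
have q_ge0 : 0 <= q by rewrite /q divr_ge0 ?mulr_ge0 ?addr_ge0 ?mulr_ge0 ?ltW.
(* The threshold is the larger root of [x ^+ 2 + 2 * c * x - q]. Moving [c] across and comparing
   squares gives [c ^+ 2 + q < (x + c) ^+ 2]. *)
have {xlt}qlt : q < x * (x + 2 * c).
  have := xlt; rewrite addrC ltrBlDr -[x + c]ger0_norm ?addr_ge0 ?(ltW x0)//.
  rewrite -sqrtr_sqr ltr_sqrt ?exprn_gt0 ?ltr_pwDl// => ?.
  by rewrite -(ltrD2l (c ^+ 2)) (lt_le_trans (y := (x + c) ^+ 2))// expr2 expr2; lra.
have s0 : 0 < si + sj by rewrite addr_gt0.
(* This is [qlt] scaled by the positive factor [(si + sj) / (si * sj)]: the diagonal entries are
   here replaced by their lower bounds [x + y] and [x + z]. *)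
have key : y * z / sk < x * (x + y) / si + x * (x + z) / sj.
  have -> : y * z / sk = q * ((si + sj) / (si * sj)).
    by rewrite /q; field; rewrite !gt_eqF.
  have -> : x * (x + y) / si + x * (x + z) / sj
     = x * (x + 2 * c) * ((si + sj) / (si * sj)).
    by rewrite /c; field; rewrite !gt_eqF// ?mulr_gt0.
  by rewrite ltr_pM2r// divr_gt0// mulr_gt0.
have Hi' : x * (x + y) / si <= x * Hi / si.
  by rewrite ler_pM2r ?invr_gt0// ler_pM2l.
have Hj' : x * (x + z) / sj <= x * Hj / sj.
  by rewrite ler_pM2r ?invr_gt0// ler_pM2l.
have -> : Hi / si * - x + (- x / sj * Hj + - y / sk * - z)
  = y * z / sk - (x * Hi / si + x * Hj / sj).
  by field; rewrite !gt_eqF.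
by rewrite subr_lt0 (lt_le_trans key)// lerD.
Qed.

End Grid.

(** * The second moment of the standard normal law is finite and positive *)

Section NormalMoment.
Context {R : realType}.
Local Notation mu := (@lebesgue_measure R).

(** The Radon-Nikodym derivative and [normal_pdf] have equal integrals over every measurable set, so
    they agree almost everywhere. *)
Lemma ge0_integral_normal_prob (m s : R) (f : R -> \bar R) :
    measurable_fun setT f -> (forall x, (0 <= f x)%E) ->
  (\int[normal_prob m s]_x f x =
   \int[mu]_x (f x * (normal_pdf m s x)%:E))%E.
Proof.
move=> mf f0; have dom := normal_prob_dominates m s.
have If := Radon_Nikodym_SigmaFinite.f_integrable dom.
have mpdf : measurable_fun setT (fun x => (normal_pdf m s x)%:E).
  by apply/measurable_EFinP; exact: measurable_normal_pdf.
rewrite -(Radon_Nikodym_SigmaFinite.change_of_variables dom f0)//.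
apply: ae_eq_integral => //.
- by apply: emeasurable_funM => //; exact: measurable_int If.
- exact: emeasurable_funM.
- apply: ae_eqe_mul2l; apply: integral_ae_eq => // E _ mE.
  by rewrite -Radon_Nikodym_SigmaFinite.f_integral.
Qed.

(* [x^2 <= 4 exp(x^2 / 4)] trades the factor [x^2] for a larger variance. *)
Lemma sqr_normal_pdf_le (x : R) : x ^+ 2 * normal_pdf 0 1 x <=
  4 * normal_peak 1 / normal_peak (Num.sqrt 2) * normal_pdf 0 (Num.sqrt 2) x.
Proof.
have s0 : Num.sqrt 2 != 0 :> R by rewrite sqrtr_eq0 -ltNge.
have p1 := @normal_peak_gt0 R 1 (oner_neq0 _).
have p2 := normal_peak_gt0 s0.
rewrite !normal_pdfE ?oner_neq0// mulrCA.
rewrite [leRHS](_ : _ = normal_peak 1 * (4 * normal_fun 0 (Num.sqrt 2) x)).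
  rewrite ler_pM2l// /normal_fun subr0 sqr_sqrtr// expr1n.
  (* Half of the exponent is kept for the density of variance 2; the other half absorbs [x ^+ 2]. *)
  have -> : - x ^+ 2 / (1 *+ 2) = - x ^+ 2 / (2 *+ 2) - x ^+ 2 / 4 :> R by field.
  rewrite expRD mulrCA [leRHS]mulrC ler_pM2l ?expR_gt0// expRN.
  rewrite ler_pdivrMr ?expR_gt0//.
  by have := expR_ge1Dx (x ^+ 2 / 4); lra.
by rewrite mulrA divfK ?gt_eqF// mulrA [4 * _]mulrC -mulrA.
Qed.

(* The value is [1], but only its sign matters: rescaling the covariance does not
   change the sign of the entries of its inverse. *)
Lemma normal_moment2 :
  exists2 c : R, 0 < c & (\int[normal_prob 0 1]_x (x ^+ 2)%:E = c%:E)%E.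
Proof.
pose c := (\int[@normal_prob R 0 1]_x (x ^+ 2)%:E)%E.
have msq : measurable_fun setT (fun x : R => (x ^+ 2)%:E).
  by apply/measurable_EFinP; exact: measurable_funX.
have c_ge0 : (0 <= c)%E by apply: integral_ge0 => x _; rewrite lee_fin sqr_ge0.
have c_fin : c \is a fin_num.
  rewrite ge0_fin_numE// /c ge0_integral_normal_prob//; last first.
    by move=> x; rewrite lee_fin sqr_ge0.
  pose K : R := 4 * normal_peak 1 / normal_peak (Num.sqrt 2).
  have K0 : 0 <= K by rewrite !mulr_ge0 ?invr_ge0 ?normal_peak_ge0.
  apply: (@le_lt_trans _ _
      (\int[mu]_x (K%:E * (normal_pdf 0 (Num.sqrt 2) x)%:E))%E).
    apply: ge0_le_integral => //.
    - by move=> x _; rewrite -EFinM lee_fin mulr_ge0 ?sqr_ge0 ?normal_pdf_ge0.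
    - apply: emeasurable_funM => //.
      by apply/measurable_EFinP; exact: measurable_normal_pdf.
    - apply: emeasurable_funM => //.
      by apply/measurable_EFinP; exact: measurable_normal_pdf.
    - by move=> x _; rewrite -!EFinM lee_fin; exact: sqr_normal_pdf_le.
  rewrite ge0_integralZl_EFin//.
  - by rewrite integral_normal_pdf mule1 ltry.
  - by move=> x _; rewrite lee_fin normal_pdf_ge0.
  - by apply/measurable_EFinP; exact: measurable_normal_pdf.
exists (fine c); last by rewrite fineK.
(* A zero second moment would concentrate the law on the point 0, which is Lebesgue-null and hence
   null for the law, so the total mass would be 0. *)
rewrite lt_neqAle fine_ge0// andbT; apply/eqP => c0.
have int0 :
    (\int[@normal_prob R 0 1]_x `|(x ^+ 2)%:E| = 0)%E.
  under eq_integral do rewrite gee0_abs ?lee_fin ?sqr_ge0//.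
  by rewrite -[LHS]/c -(fineK c_fin) -c0.
have [A [mA A0 sqA]] := 
  (ae_eq_integral_abs (@normal_prob R 0 1) measurableT msq).1 int0.
have N0 : @normal_prob R 0 1 [set 0] = 0%E.
  apply: (null_content_dominatesP _ _).1 (@normal_prob_dominates R 0 1) _ _ _ => //.
  exact: lebesgue_measure_set1.
have : (@normal_prob R 0 1 setT <= 0)%E.
  rewrite -N0 -[leRHS]adde0 -[in leRHS]A0.
  apply: (le_trans (y := normal_prob 0 1 ([set 0] `|` A)%classic)).
    apply: le_measure; rewrite ?inE//; first exact: measurableU.
    move=> x _; have [->|x0] := eqVneq x 0; [by left|right; apply: sqA => /=].
    move=> /(_ I) => -[] /eqP; rewrite sqrf_eq0; exact/negP.
  by apply: measureU2.
by rewrite probability_setT lee_fin ler10.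
Qed.

End NormalMoment.

(** * Moments of linear forms in a centred Gaussian vector *)

Section Gaussian.
Context d (Omega : measurableType d) (R : realType) (P : probability Omega R).
Variables (N : nat) (X : 'I_N -> {RV P >-> R}) (Sigma : 'M[R]_N).
Hypothesis gaussX : gaussian X 0 Sigma.
Hypothesis Sigma_sym : Sigma^T = Sigma.
Hypothesis Sigma_psd : forall a : 'rV[R]_N, 0 <= (a *m Sigma *m a^T) 0 0.

Definition lin (a : 'rV[R]_N) (w : Omega) : R := (a *m vec X w) 0 0.
Definition bil (a b : 'rV[R]_N) : R := (a *m Sigma *m b^T) 0 0.

Lemma linD a b w : lin (a + b) w = lin a w + lin b w.
Proof. by rewrite /lin mulmxDl mxE. Qed.

Lemma linZ k a w : lin (k *: a) w = k * lin a w.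
Proof. by rewrite /lin -scalemxAl mxE. Qed.

Lemma bilC a b : bil a b = bil b a.
Proof.
have : (a *m Sigma *m b^T)^T = b *m Sigma *m a^T.
  by rewrite !trmx_mul trmxK Sigma_sym mulmxA.
by rewrite /bil => <-; rewrite [RHS]mxE.
Qed.

Lemma bilDl a b c : bil (a + b) c = bil a c + bil b c.
Proof. by rewrite /bil !mulmxDl mxE. Qed.

Lemma bilZl k a b : bil (k *: a) b = k * bil a b.
Proof. by rewrite /bil -!scalemxAl mxE. Qed.

Lemma measurable_lin a : measurable_fun setT (lin a).
Proof.
rewrite (_ : lin a = fun w => \sum_(i < N) a 0 i * X i w).
  by apply: measurable_sum => i; exact: measurable_funM.
by apply/funext => w; rewrite /lin mxE; apply: eq_bigr => i _; rewrite mxE.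
Qed.

Lemma lin_law a (A : set R) : measurable A ->
  pushforward P (lin a) A = normal_law 0 (bil a a) A.
Proof. by move=> mA; have := gaussX a mA; rewrite mulmx0 mxE. Qed.

(** [normal_law] is a bare set function; [m] is a genuine measure agreeing with it, against which
    one can integrate. *)
Lemma ge0_integral_lin a (m : probability (measurableTypeR R) R) (f : R -> \bar R) :
    (forall A : set R, measurable A -> m A = normal_law 0 (bil a a) A) ->
    measurable_fun setT f -> (forall x, (0 <= f x)%E) ->
  (\int[P]_w f (lin a w) = \int[m]_x f x)%E.
Proof.
move=> mE mf f0.
rewrite -[LHS](@ge0_integral_pushforward _ _ _ (measurableTypeR R) _ _
  (measurable_lin a) P _ _ measurableT mf)//.
apply: eq_measure_integral; [exact: measurable_lin|move=> ma A mA _].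
rewrite [LHS]lin_law//; exact/esym/mE.
Qed.

Let measurable_sqr : measurable_fun setT (fun x : R => (x ^+ 2)%:E).
Proof. by apply/measurable_EFinP; exact: measurable_funX. Qed.

Let sqr_ge0e (x : R) : (0 <= (x ^+ 2)%:E)%E.
Proof. by rewrite lee_fin sqr_ge0. Qed.

(* For a degenerate form the law is a Dirac mass; otherwise rescale the form to
   variance [1]. *)
Lemma integral_lin_sqr c :
    (\int[normal_prob 0 1]_x (x ^+ 2)%:E = c%:E)%E ->
  forall a, (\int[P]_w (lin a w ^+ 2)%:E = (c * bil a a)%:E)%E.
Proof.
move=> cE a; have [v0|v_neq0] := eqVneq (bil a a) 0.
  rewrite (@ge0_integral_lin a (\d_ (0 : measurableTypeR R)) (fun x => (x ^+ 2)%:E))//.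
    by rewrite integral_dirac// diracT mul1e expr0n v0 mulr0.
  by move=> A mA; rewrite /normal_law v0 eqxx.
have v_gt0 : 0 < bil a a by rewrite lt_neqAle eq_sym v_neq0 Sigma_psd.
pose s := Num.sqrt (bil a a); pose b := s^-1 *: a.
have s_neq0 : s != 0 by rewrite sqrtr_eq0 -ltNge.
have bb : bil b b = 1.
  rewrite bilZl bilC bilZl mulrA -expr2 exprVn sqr_sqrtr ?ltW//.
  by rewrite mulVf.
under eq_integral => w _.
  have -> : lin a w = s * lin b w by rewrite linZ mulrA divff// mul1r.
  rewrite exprMn sqr_sqrtr ?ltW// EFinM.
  over.
rewrite ge0_integralZl_EFin ?ltW//; last first.
  by apply/measurable_EFinP/measurable_funX; exact: measurable_lin.
rewrite (@ge0_integral_lin b (normal_prob 0 1) (fun x => (x ^+ 2)%:E))//.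
  by rewrite cE -EFinM mulrC.
by move=> A mA; rewrite /normal_law bb oner_eq0 sqrtr1.
Qed.

Lemma integrable_lin_sqr a : P.-integrable setT (fun w => (lin a w ^+ 2)%:E).
Proof.
have [c _ cE] := @normal_moment2 R.
apply/integrableP; split.
  by apply/measurable_EFinP/measurable_funX; exact: measurable_lin.
under eq_integral do rewrite gee0_abs//.
by rewrite (integral_lin_sqr cE) ltry.
Qed.

(** Domination: [|x| <= x ^+ 2 + 1], and constants are integrable for a probability. *)
Lemma integrable_lin a : P.-integrable setT (EFin \o lin a).
Proof.
apply: (le_integrable measurableT
  (g := fun w => ((lin a w ^+ 2)%:E + (cst 1 w)%:E)%E)) => //.
- by apply/measurable_EFinP; exact: measurable_lin.
- move=> w _ /=; rewrite lee_fin [leRHS]ger0_norm ?addr_ge0 ?sqr_ge0//.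
  by rewrite -[lin a w ^+ 2]real_normK ?num_real//; nra.
- apply: integrableD => //; first exact: integrable_lin_sqr.
  exact: finite_measure_integrable_cst.
Qed.

(** Domination by the sum of the two squares, from [(|x| - |y|) ^+ 2 >= 0]. *)
Lemma integrable_linM a b : P.-integrable setT (fun w => (lin a w * lin b w)%:E).
Proof.
apply: (le_integrable measurableT
  (g := fun w => ((lin a w ^+ 2)%:E + (lin b w ^+ 2)%:E)%E)) => //.
- by apply/measurable_EFinP/measurable_funM; exact: measurable_lin.
- move=> w _ /=; rewrite lee_fin [leRHS]ger0_norm ?addr_ge0 ?sqr_ge0//.
  rewrite normrM -[lin a w ^+ 2]real_normK ?num_real//.
  rewrite -[lin b w ^+ 2]real_normK ?num_real//.
  by have := sqr_ge0 (`|lin a w| - `|lin b w|); nra.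
- by apply: integrableD => //; exact: integrable_lin_sqr.
Qed.

(* [lin a] and [- lin a = lin (- a)] have the same law. *)
Lemma expectation_lin a : 'E_P[lin a]%E = 0%E.
Proof.
have iN : P.-integrable setT (EFin \o lin (- a)) by exact: integrable_lin.
have bNN : bil (- a) (- a) = bil a a.
  by rewrite -scaleN1r bilZl bilC bilZl !mulN1r opprK.
have EN : 'E_P[lin a]%E = 'E_P[lin (- a)]%E.
  have E b : 'E_P[lin b]%E = (\int[pushforward P (lin b)]_x x%:E)%E.
    rewrite unlock (integral_pushforward (measurable_lin b))//.
    exact: integrable_lin.
  rewrite !E.
  apply: eq_measure_integral; [exact: measurable_lin..|move=> ma mNa A mA _].
  by transitivity (normal_law 0 (bil a a) A); [|rewrite -bNN; apply: esym];
    exact: lin_law.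
have L1 : lin a \in Lfun P 1 by exact/Lfun1_integrable/integrable_lin.
have fin : 'E_P[lin a]%E \is a fin_num by exact: expectation_fin_num.
have : 'E_P[lin (- a)]%E = (- 'E_P[lin a])%E.
  rewrite -[RHS]mulN1e -expectationZl//; congr expectation.
  by apply/funext => w; rewrite -scaleN1r linZ/= mulrC.
rewrite -EN -(fineK fin) -EFinN; move: (fine _) => r [rN]; congr EFin; lra.
Qed.

(** Polarization: the means vanish, so the covariance is the integral of the product, read off by
    expanding the second moment of [lin (a + b)]. *)
Lemma covariance_lin c :
    (\int[normal_prob 0 1]_x (x ^+ 2)%:E = c%:E)%E ->
  forall a b, covariance P (lin a) (lin b) = (c * bil a b)%:E.
Proof.
move=> cE a b.
have iab := integrable_linM a b; have iaa := integrable_lin_sqr a.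
have ibb := integrable_lin_sqr b.
rewrite covarianceE; [|exact/Lfun1_integrable/integrable_lin..|]; last first.
  exact/Lfun1_integrable.
rewrite !expectation_lin mule0 sube0 unlock.
set I := integral _ _ _.
have fin : I \is a fin_num by exact: integrable_fin_num.
have := integral_lin_sqr cE (a + b).
under eq_integral => w _.
  rewrite linD sqrrD mulr2n addrA EFinD EFinD EFinD; over.
rewrite integralD//; last first.
  by apply: integrableD => //; apply: integrableD.
rewrite integralD//; last by apply: integrableD.
rewrite integralD// !(integral_lin_sqr cE) -/I -(fineK fin) -!EFinD.
move: (fine I) => r [].
rewrite bilDl ![bil _ (a + b)]bilC !bilDl [bil b a]bilC => Iab.
by congr EFin; lra.
Qed.

End Gaussian.

(** * Matrix identities and the inverse covariance of the phase angles *)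

Lemma invmx_uniq (R : comUnitRingType) (n : nat) (A B : 'M[R]_n) :
  A *m B = 1%:M -> invmx A = B.
Proof.
by move=> AB; have [uA _] := mulmx1_unit AB; rewrite -[RHS](mulKmx uA) AB mulmx1.
Qed.

Lemma is_diag_mxE (R : nmodType) (n : nat) (A : 'M[R]_n) :
  is_diag_mx A -> A = diag_mx (\row_a A a a).
Proof.
move=> /is_diag_mxP dA; apply/matrixP => i j; rewrite !mxE.
by have [->|/dA] := eqVneq i j.
Qed.

Lemma diag_psd (R : realDomainType) (n : nat) (s a : 'rV[R]_n) :
  (forall i, 0 <= s 0 i) -> 0 <= (a *m diag_mx s *m a^T) 0 0.
Proof.
move=> s_ge0; rewrite mul_mx_diag mxE sumr_ge0// => i _; rewrite !mxE.
by rewrite mulrAC mulr_ge0// -expr2 sqr_ge0.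
Qed.

Theorem theorem8 (R : realType) (N : nat) (G : grid R N)
    (d : measure_display) (Omega : measurableType d) (P : probability Omega R)
    (p theta : 'I_N -> {RV P >-> R}) (Sigma_p : 'M[R]_N)
    (Sigma_diag : is_diag_mx Sigma_p)
    (Sigma_gt0 : forall a, 0 < Sigma_p a a)
    (p_gauss : gaussian p 0 Sigma_p)
    (dc_flow : forall w, vec p w = laplacian G *m vec theta w)
    (i j k : 'I_N)
    (edge_ij : edge G i j) (edge_jk : edge G j k) (edge_ik : edge G i k)
    (one_triangle : triangles_on G i j = [set [set i; j; k]]%SET) :
  let sigma a := Sigma_p a a in
  let b := (sigma j * beta G i k + sigma i * beta G j k)
             / (2 * (sigma i + sigma j)) in
  beta G i j > - b + Num.sqrt (b ^+ 2
    + (sigma i * sigma j * beta G i k * beta G j k)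
        / (sigma k * (sigma i + sigma j))) ->
  invmx (cov_mx theta) i j < 0.
Proof.
move=> sigma b beta_gt.
have [c c_gt0 cE] := @normal_moment2 R.
set H := laplacian G in dc_flow *.
have uH : H \in unitmx by exact: laplacian_unit.
have SigmaE := is_diag_mxE Sigma_diag.
have Sigma_sym : Sigma_p^T = Sigma_p by rewrite SigmaE tr_diag_mx.
have Sigma_psd (a : 'rV[R]_N) : 0 <= (a *m Sigma_p *m a^T) 0 0.
  by rewrite SigmaE diag_psd// => l; rewrite mxE ltW.
(* Solving the flow equation makes each phase angle a linear form in the injections. *)
have thetaE l : theta l = lin p (row l (invmx H)) :> (Omega -> R).
  by apply/funext => w; rewrite /lin dc_flow -row_mul mulKmx// !mxE.
have covE : cov_mx theta = c *: (invmx H *m Sigma_p *m (invmx H)^T).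
  apply/matrixP => l m; rewrite 2!mxE !thetaE.
  rewrite (covariance_lin p_gauss Sigma_sym Sigma_psd cE)/= /bil.
  rewrite -row_mul tr_row [in LHS]mxE [in RHS]mxE; congr (_ * _).
  by apply: eq_bigr => x _; rewrite [row _ _ _ _]mxE [col _ _ _ _]mxE.
pose D : 'M[R]_N := diag_mx (\row_a (Sigma_p a a)^-1).
have SigmaD : Sigma_p *m D = 1%:M.
  rewrite SigmaE mulmx_diag -[RHS]diag_const_mx; congr diag_mx.
  by apply/rowP => l; rewrite !mxE divff// gt_eqF.
have -> : invmx (cov_mx theta) = c^-1 *: (H *m D *m H).
  apply: invmx_uniq; rewrite covE -scalemxAl -scalemxAr scalerA divff ?gt_eqF//.
  rewrite scale1r trmx_inv laplacian_tr -/H !mulmxA mulmxKV//.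
  by rewrite -(mulmxA (invmx H)) SigmaD mulmx1 mulVmx.
(* The positive factor [c^-1] leaves the sign alone; transposing the left [H] puts the summation
   index first in both Laplacian entries. *)
rewrite mxE pmulr_rlt0 ?invr_gt0// -{1}[H]laplacian_tr mxE.
under eq_bigr => l _ do
  rewrite mul_mx_diag mxE [H^T _ _]mxE [(\row__ _) _ _]mxE.
exact: (weighted_laplacian_sqr_lt0 Sigma_gt0 edge_ij edge_jk edge_ik).
Qed.
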